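(* Let $G$ be an $r$-regular non-bipartite connected graph of order $n$ with $m$ edges and $r\geq 2$. Let $r=\lambda_0>\lambda_1>\cdots>\lambda_d$ be all distinct eigenvalues of the adjacency matrix $A(G)$, where $\lambda_i$ has multiplicity $a_i$, and let $x_1^{(i)},\ldots,x_{a_i}^{(i)}$ be unit orthogonal eigenvectors of $A(G)$ for $\lambda_i$, $i\in[d]\cup\{0\}$. Let $R_G$ be the $n\times m$ vertex-edge incidence matrix of $G$, and let $\zeta_1,\ldots,\zeta_{m-n}$ be all unit orthogonal vectors (of order $m$) with $R_G\zeta_k=0$. Then the spectrum of the $\mathcal{Q}$-graph $\mathcal{Q}(G)$ consists precisely of the following: (i) $\lambda_{i\pm}=\frac{r+\lambda_i-2\pm\sqrt{(\lambda_i+r)^2+4}}{2}$, $i\in[d]\cup\{0\}$, with corresponding unit orthogonal eigenvectors $$X_{i\pm}^j=\frac{1}{\sqrt{(\lambda_{i\pm}+2-r-\lambda_i)^2+\lambda_i+r}}\begin{pmatrix}(\lambda_{i\pm}+2-r-\lambda_i)x_j^{(i)}\\ R_G^T x_j^{(i)}\end{pmatrix},\quad j\in[a_i];$$ (ii) $-2$, with multiplicity $m-n$, with corresponding orthogonal eigenvectors $Y_k=\frac{1}{\|\zeta_k\|}\begin{pmatrix}0\\ \zeta_k\end{pmatrix}$, $k\in[m-n]$.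
   Context: $\mathcal{Q}(G)$ is obtained from $G$ by inserting a new vertex on each edge of $G$ and joining two new vertices by an edge whenever the corresponding edges of $G$ are adjacent. Its adjacency matrix is $A(\mathcal{Q}(G))=\begin{pmatrix}O & R_G\\ R_G^T & A(\ell(G))\end{pmatrix}$, with the original vertices of $G$ listed first, where $\ell(G)$ is the line graph of $G$ and $A(\ell(G))=R_G^TR_G-2I_m$. For an $n\times m$ incidence matrix the space $\{\zeta: R_G\zeta=0\}$ has dimension $m-n$ when $G$ is non-bipartite. $[n]=\{1,\ldots,n\}$. *)

(* Defs.v *)
From HB Require Import structures.
From mathcomp Require Import all_boot all_order all_algebra.

Set Implicit Arguments.
Unset Strict Implicit.
Unset Printing Implicit Defensive.

Import Order.TTheory GRing.Theory Num.Theory.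
Local Open Scope ring_scope.

Record sgraph := SGraph {
  vertex :> finType;
  adj : rel vertex;
  adj_sym : symmetric adj;
  adj_irr : irreflexive adj }.

Section Graphs.
Variable G : sgraph.

Definition regular (r : nat) : Prop :=
  forall v : G, #|[set w | adj v w]| = r.

Definition connected : Prop :=
  (0 < #|G|)%N /\ forall u v : G, connect (@adj G) u v.

Definition bipartite : Prop :=
  exists A : {set G}, forall u v : G, adj u v -> (u \in A) != (v \in A).

Definition is_edge (f : {set G}) : bool :=
  [exists u : G, exists v : G, adj u v && (f == [set u; v])].

Definition edge : finType := {f : {set G} | is_edge f}.

Definition ladj (f g : edge) : bool :=
  (f != g) && (val f :&: val g != set0).

Lemma ladj_sym : symmetric ladj.
Proof. by move=> f g; rewrite /ladj eq_sym setIC. Qed.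

Lemma ladj_irr : irreflexive ladj.
Proof. by move=> f; rewrite /ladj eqxx. Qed.

Definition line_graph : sgraph := SGraph ladj_sym ladj_irr.

(* [inr f] is the new vertex inserted on the edge [f]. *)
Definition qadj (p q : (G + edge)%type) : bool :=
  match p, q with
  | inl _, inl _ => false
  | inl v, inr f | inr f, inl v => v \in val f
  | inr f, inr g => ladj f g
  end.

Lemma qadj_sym : symmetric qadj.
Proof. by case=> [u|f] [v|g] //=; apply: ladj_sym. Qed.

Lemma qadj_irr : irreflexive qadj.
Proof. by case=> [u|f] //=; apply: ladj_irr. Qed.

Definition Qgraph : sgraph := SGraph qadj_sym qadj_irr.

(* The original vertices come first. *)
Definition Qlabel (i : 'I_(#|G| + #|edge|)) : Qgraph :=
  match split i with
  | inl u => inl (enum_val u)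
  | inr k => inr (enum_val k)
  end.

End Graphs.

Section Matrices.
Variable R : rcfType.

Definition adjmx_lab (G : sgraph) n (lab : 'I_n -> G) : 'M[R]_n :=
  \matrix_(i, j) (adj (lab i) (lab j))%:R.

Definition adjmx (G : sgraph) : 'M[R]_#|G| := adjmx_lab (fun i : 'I_#|G| => enum_val i).

Definition incmx (G : sgraph) : 'M[R]_(#|G|, #|edge G|) :=
  \matrix_(i < #|G|, k < #|edge G|) (enum_val i \in val (enum_val k))%:R.

Definition adjmxQ (G : sgraph) : 'M[R]_(#|G| + #|edge G|) :=
  adjmx_lab (@Qlabel G).

Lemma Qlabel_bij (G : sgraph) : bijective (@Qlabel G).
Proof.
pose g (p : Qgraph G) : 'I_(#|G| + #|edge G|) :=
  match p with inl u => lshift _ (enum_rank u)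
             | inr k => rshift _ (enum_rank k) end.
exists g => [i|].
  rewrite /Qlabel -[RHS]splitK.
  by case: (split i) => j /=; rewrite enum_valK.
case=> [u|f]; rewrite /g /Qlabel.
  by rewrite (unsplitK (inl _)) enum_rankK.
by rewrite (unsplitK (inr _)) enum_rankK.
Qed.

Lemma adjmxQE (G : sgraph) :
  adjmxQ G = block_mx 0 (incmx G) (incmx G)^T (adjmx (line_graph G)).
Proof.
apply/matrixP=> i j; rewrite -[i]splitK -[j]splitK.
case: (split i) => i'; case: (split j) => j' /=;
  rewrite ?(block_mxEul, block_mxEur, block_mxEdl, block_mxEdr) !mxE /Qlabel;
  by rewrite ?(unsplitK (inl _)) ?(unsplitK (inr _)).
Qed.

Definition dotv n (u v : 'cV[R]_n) : R := (u^T *m v) 0 0.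

Definition norm2 n (v : 'cV[R]_n) : R := Num.sqrt (dotv v v).

Definition orthonormal_fam n (I : eqType) (v : I -> 'cV[R]_n) : Prop :=
  forall i j, dotv (v i) (v j) = (i == j)%:R.

Definition eigenvector n (A : 'M[R]_n) (mu : R) (v : 'cV[R]_n) : Prop :=
  v != 0 /\ A *m v = mu *: v.

Definition multiplicity n (A : 'M[R]_n) (mu : R) : nat :=
  mup mu (char_poly A).

(* [s = false] is the sign +, [s = true] the sign -. *)
Definition lamQ (r : nat) (s : bool) (l : R) : R :=
  (r%:R + l - 2 + (-1) ^+ s * Num.sqrt ((l + r%:R) ^+ 2 + 4)) / 2.

Definition vecX (G : sgraph) (r : nat) (s : bool) (l : R) (x : 'cV[R]_#|G|) :
    'cV[R]_(#|G| + #|edge G|) :=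
  let c := lamQ r s l + 2 - r%:R - l in
  (Num.sqrt (c ^+ 2 + l + r%:R))^-1 *: col_mx (c *: x) ((incmx G)^T *m x).

Definition vecY (G : sgraph) (z : 'cV[R]_#|edge G|) :
    'cV[R]_(#|G| + #|edge G|) :=
  (norm2 z)^-1 *: col_mx 0 z.

End Matrices.

(* Main.v *)
Require Import Defs.
From HB Require Import structures.
From mathcomp Require Import all_boot all_order all_algebra.
From mathcomp Require Import spectral complex ring lra.

(* With N the incidence matrix, N N^T = A(G) + r I and N^T N = A(l(G)) + 2 I.
   If A(G) x = l x, the span of (x, 0) and (0, N^T x) is therefore invariant
   under A(Q(G)), which has on it the eigenvalues t solving
   t (t + 2 - r - l) = l + r. Non-bipartiteness gives l + r > 0, which makes
   these values pairwise distinct and different from -2. As A(G) is symmetric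
   its multiplicities sum to n, and comparing the traces of N N^T and N^T N
   gives 2 m = r n >= 2 n. Hence the vectors X and Y form an orthonormal family
   of 2 n + (m - n) = n + m eigenvectors, which determines the characteristic
   polynomial; in particular the rank of N is never needed. *)

Set Implicit Arguments.
Unset Strict Implicit.
Unset Printing Implicit Defensive.

Import Order.TTheory GRing.Theory Num.Theory.
Local Open Scope ring_scope.

(** * Characteristic polynomials of diagonalisable matrices, and root multiplicities *)

(** Take determinants in [P (X - A) = (X - D) P] over polynomials: [\det P] is a nonzero constant
    and cancels. *)
Lemma char_poly_diagonalized (F : fieldType) n (A P : 'M[F]_n) (d : 'rV[F]_n) :
  P \in unitmx -> P *m A = diag_mx d *m P ->
  char_poly A = \prod_i ('X - (d 0 i)%:P).
Proof.
move=> Pu PA; have -> : \prod_i ('X - (d 0 i)%:P) = char_poly (diag_mx d).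
  rewrite char_poly_trig ?diag_mx_is_trig //; apply: eq_bigr => i _.
  by rewrite mxE eqxx mulr1n.
have detP0 : \det (map_mx polyC P) != 0.
  by rewrite det_map_mx polyC_eq0 -unitfE -unitmxE.
apply: (mulfI detP0); rewrite [RHS]mulrC /char_poly -!det_mulmx; congr (\det _).
rewrite /char_poly_mx mulmxBr mulmxBl -!map_mxM PA.
by rewrite mul_mx_scalar mul_scalar_mx.
Qed.

(** Over the complex extension [A] becomes hermitian, hence unitarily diagonalisable with real
    eigenvalues; the factorisation descends to [R] because extending coefficients is injective. *)
Lemma symmetric_char_poly_split (R : rcfType) n (A : 'M[R]_n) :
  A^T = A -> exists s : seq R, char_poly A = \prod_(z <- s) ('X - z%:P).
Proof.
move=> symA; pose f := real_complex R; pose B := map_mx f A.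
have hermB : B \is hermsymmx.
  apply/realsym_hermsym.
    by apply/is_hermitianmxP; rewrite expr0 scale1r map_mx_id // map_trmx symA.
  by apply/mxOverP => i j; rewrite mxE; apply/complex_realP; exists (A i j).
have /hermitian_normalmx/orthomx_spectralP B_eq := hermB.
have Pu := spectral_unit B.
set P := spectralmx B in B_eq Pu; set d := spectral_diag B in B_eq.
have PB : P *m B = diag_mx d *m P.
  by rewrite [in LHS]B_eq !mulmxA mulmxV // mul1mx.
exists [seq complex.Re (d 0 i) | i <- index_enum 'I_n].
apply: (map_poly_inj f).
rewrite map_char_poly (char_poly_diagonalized Pu PB) big_map rmorph_prod /=.
apply: eq_bigr => i _; rewrite rmorphB /= map_polyX map_polyC /= /f RRe_real //.
by have /mxOverP := hermitian_spectral_diag_real hermB; apply.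
Qed.

Lemma mup_prod_XsubCX (F : fieldType) (I : finType) (f : I -> F) (k : I -> nat) z :
  mup z (\prod_i ('X - (f i)%:P) ^+ k i) = (\sum_(i | f i == z) k i)%N.
Proof.
have p0 i : ('X - (f i)%:P) ^+ k i != 0 by rewrite expf_neq0 ?polyXsubC_eq0.
rewrite [RHS]big_mkcond /=.
(* Nonvanishing is carried along with the count, since additivity of [mup] on products requires
   nonzero polynomials. *)
suff [] : mup z (\prod_i ('X - (f i)%:P) ^+ k i)
    = (\sum_i if f i == z then k i else 0)%N /\
    \prod_i ('X - (f i)%:P) ^+ k i != 0 by [].
apply: (big_rec2 (fun p m => mup z p = m /\ p != 0)) => [|i m p _ [<- pn0]].
  by rewrite mupNroot ?root1 ?oner_neq0.
by rewrite mupM // mup_XsubCX mulf_neq0.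
Qed.

(** * The real inner product and orthonormal eigenvectors *)

Section Dot.
Variable R : rcfType.

Lemma dotvE n (u v : 'cV[R]_n) : dotv u v = \sum_i u i 0 * v i 0.
Proof. by rewrite /dotv mxE; apply: eq_bigr => i _; rewrite mxE. Qed.

Lemma dotvC n (u v : 'cV[R]_n) : dotv u v = dotv v u.
Proof. by rewrite !dotvE; apply: eq_bigr => i _; rewrite mulrC. Qed.

Lemma dotvZl n c (u v : 'cV[R]_n) : dotv (c *: u) v = c * dotv u v.
Proof. by rewrite /dotv linearZ /= -scalemxAl mxE. Qed.

Lemma dotvZr n c (u v : 'cV[R]_n) : dotv u (c *: v) = c * dotv u v.
Proof. by rewrite /dotv -scalemxAr mxE. Qed.

Lemma dotv0l n (u : 'cV[R]_n) : dotv 0 u = 0.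
Proof. by rewrite /dotv trmx0 mul0mx mxE. Qed.

Lemma dotv0r n (u : 'cV[R]_n) : dotv u 0 = 0.
Proof. by rewrite /dotv mulmx0 mxE. Qed.

Lemma dotv_trl m n (M : 'M[R]_(m, n)) u v : dotv (M^T *m u) v = dotv u (M *m v).
Proof. by rewrite /dotv trmx_mul trmxK mulmxA. Qed.

Lemma dotv_col_mx m n (a c : 'cV[R]_m) (b d : 'cV[R]_n) :
  dotv (col_mx a b) (col_mx c d) = dotv a c + dotv b d.
Proof. by rewrite /dotv tr_col_mx mul_row_col mxE. Qed.

Lemma dotv_ge0 n (u : 'cV[R]_n) : 0 <= dotv u u.
Proof. by rewrite dotvE sumr_ge0 // => i _; rewrite -expr2 sqr_ge0. Qed.

Lemma dotv_eq0 n (u : 'cV[R]_n) : (dotv u u == 0) = (u == 0).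
Proof.
apply/eqP/eqP => [|->]; last exact: dotv0l.
rewrite dotvE => /psumr_eq0P u0; apply/colP => i; rewrite mxE; apply/eqP.
by rewrite -sqrf_eq0 expr2 u0 // => j _; rewrite -expr2 sqr_ge0.
Qed.

Lemma eigenvector_dot0 n (A : 'M[R]_n) l l' (u v : 'cV[R]_n) :
  A^T = A -> A *m u = l *: u -> A *m v = l' *: v -> l != l' -> dotv u v = 0.
Proof.
move=> symA Au Av ne; apply/eqP; move: (dotv_trl A u v).
rewrite symA Au Av dotvZl dotvZr => /eqP; rewrite -subr_eq0 -mulrBl mulf_eq0.
by rewrite subr_eq0 (negPf ne).
Qed.

(** With the [v i] as rows of [P], orthonormality reads [P P^T = 1]; there are [n] of them, so [P]
    is square, hence invertible, and it diagonalises [A]. *)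
Lemma char_poly_orthonormal n (A : 'M[R]_n) (I : finType) (mu : I -> R)
    (v : I -> 'cV[R]_n) :
  A^T = A -> #|I| = n -> orthonormal_fam v ->
  (forall i, A *m v i = mu i *: v i) ->
  char_poly A = \prod_i ('X - (mu i)%:P).
Proof.
(* The enumeration of [I] is abstracted first, so that rewriting [#|I|] into [n] gives it domain
   ['I_n] without a cast. *)
move=> symA; move: (@enum_val I predT) (@enum_val_bij I) => e0 e0_bij.
move=> cardI; move: cardI e0 e0_bij => -> e e_bij orth_v eig.
pose P := \matrix_(i < n, j < n) v (e i) j 0.
have PPT : P *m P^T = 1%:M.
  apply/matrixP => i j; rewrite !mxE -(inj_eq (bij_inj e_bij)) -orth_v dotvE.
  by apply: eq_bigr => k _; rewrite !mxE.
have [Pu _] := mulmx1_unit PPT.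
rewrite (char_poly_diagonalized Pu (d := \row_i mu (e i))).
  rewrite [RHS](reindex e) /=; last exact: onW_bij.
  by apply: eq_bigr => i _; rewrite mxE.
apply/matrixP => i j; rewrite mul_diag_mx mxE.
have /matrixP/(_ j 0) := eig (e i); rewrite !mxE => <-.
by apply: eq_bigr => k _; rewrite !mxE mulrC -{1}symA mxE.
Qed.

End Dot.

(** * Counting in the graph and the two products of the incidence matrix *)

(** The entries of [N N^T] and [N^T N] have this shape: they count the edges common to two vertices
    and the vertices common to two edges. *)
Lemma sum_mul_mem (R : pzSemiRingType) (T : finType) (A B : {set T}) :
  \sum_(i < #|T|) (enum_val i \in A)%:R * (enum_val i \in B)%:R
    = #|A :&: B|%:R :> R.
Proof.
rewrite -(big_enum_val (A := T) (fun t => (t \in A)%:R * (t \in B)%:R)) /=.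
rewrite -sum1_card natr_sum [RHS]big_mkcond; apply: eq_bigr => t _.
by rewrite inE -natrM mulnb; case: (_ && _).
Qed.

Section Incidence.
Variables (R : rcfType) (G : sgraph).
Local Notation N := (incmx R G).

Lemma adj_neq (u v : G) : adj u v -> u != v.
Proof. by apply: contraTneq => ->; rewrite adj_irr. Qed.

Lemma edge_pair (u v : G) : adj u v -> {f : edge G | val f = [set u; v]}.
Proof.
move=> uv; have e : is_edge [set u; v].
  by apply/existsP; exists u; apply/existsP; exists v; rewrite uv eqxx.
by exists (exist (fun F => is_edge F) [set u; v] e).
Qed.

Lemma mem_edge (f : edge G) u : u \in val f ->
  exists2 w, adj u w & val f = [set u; w].
Proof.
case/existsP: (valP f) => a /existsP[b /andP[ab /eqP->]].
by case/set2P=> ->; [exists b | exists a]; rewrite // 1?adj_sym // setUC.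
Qed.

Lemma card_edge (f : edge G) : #|val f| = 2%N.
Proof.
case/existsP: (valP f) => a /existsP[b /andP[/adj_neq ab /eqP->]].
by rewrite cards2 ab.
Qed.

(** An edge at [v] is determined by its other end, so both sides count the pairs [[set v; w]] with
    [w] adjacent to [v]. *)
Lemma card_incident (v : G) :
  #|[set f : edge G | v \in val f]| = #|[set w | adj v w]|.
Proof.
rewrite -(card_imset _ val_inj).
have -> : [set val f | f in [set f : edge G | v \in val f]]
          = [set [set v; w] | w in [set w | adj v w]].
  apply/setP => F; apply/imsetP/imsetP => [[f]|[w]].
    by rewrite inE => /mem_edge[w vw ->] ->; exists w; rewrite ?inE.
  rewrite inE => /edge_pair[f Df] ->; exists f; rewrite ?inE Df ?set21 //.
apply: card_in_imset => w w'; rewrite !inE => vw vw' /setP/(_ w).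
by rewrite set22 => /esym/set2P[] // Dw; rewrite Dw adj_irr in vw.
Qed.

(** An edge containing two distinct vertices must be the pair they form. *)
Lemma card_edges_between (u v : G) : u != v ->
  #|[set f : edge G | u \in val f] :&: [set f : edge G | v \in val f]| = adj u v.
Proof.
move=> ne; have Df (f : edge G) : u \in val f -> v \in val f ->
    adj u v /\ val f = [set u; v].
  case/mem_edge => w uw ->; rewrite !inE eq_sym (negPf ne) /=.
  by move/eqP->.
case: (boolP (adj u v)) => [/edge_pair[f fE]|/negP nuv].
  apply/eqP/cards1P; exists f; apply/setP => g; rewrite !inE.
  apply/andP/eqP => [[ug vg]|->]; last by rewrite fE set21 set22.
  by apply: val_inj; rewrite fE; have [] := Df g ug vg.
apply/eqP; rewrite cards_eq0; apply/eqP/setP => g; rewrite !inE.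
by apply/negP => /andP[/Df h /h[]].
Qed.

(** Two common vertices would fill both edges, each of size 2, and force [f = g]. *)
Lemma card_edgeI (f g : edge G) : f != g -> #|val f :&: val g| = ladj f g.
Proof.
move=> ne; rewrite /ladj ne /=; have [->|[u]] := set_0Vmem (val f :&: val g).
  by rewrite cards0 eqxx.
rewrite inE => /andP[uf ug]; have -> : val f :&: val g = [set u].
  apply/eqP; rewrite eq_sym eqEcard sub1set inE uf ug cards1 /=.
  rewrite leqNgt; apply: contra ne => gt1; apply/eqP/val_inj.
  have Ef : val f :&: val g = val f.
    by apply/eqP; rewrite eqEcard subsetIl card_edge.
  have Eg : val f :&: val g = val g.
    by apply/eqP; rewrite eqEcard subsetIr card_edge.
  by rewrite -Ef Eg.
rewrite cards1; suff /set0Pn -> : exists x, x \in [set u] by [].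
by exists u; rewrite inE.
Qed.

Lemma incmx_mul_tr r : regular G r -> N *m N^T = adjmx R G + r%:R%:M.
Proof.
move=> regG; apply/matrixP => i j; rewrite !mxE.
under eq_bigr do rewrite !mxE.
(* Incidence is recast as membership in a set of edges, the form to which [sum_mul_mem] applies when
   the sum runs over edges. *)
have inE' u (f : edge G) : (u \in val f) = (f \in [set g : edge G | u \in val g]).
  by rewrite inE.
under eq_bigr do rewrite !inE'.
rewrite sum_mul_mem; have [->|ne] := eqVneq i j.
  rewrite setIid.
  by rewrite card_incident regG adj_irr mulr1n add0r.
by rewrite card_edges_between ?(inj_eq enum_val_inj) // mulr0n addr0.
Qed.

Lemma tr_mul_incmx : N^T *m N = adjmx R (line_graph G) + 2%:M.
Proof.
apply/matrixP => i j; rewrite !mxE.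
under eq_bigr do rewrite !mxE.
rewrite sum_mul_mem.
have [->|ne] := eqVneq i j.
  by rewrite setIid card_edge adj_irr mulr1n add0r.
by rewrite card_edgeI ?(inj_eq enum_val_inj) // mulr0n addr0.
Qed.

Lemma mxtrace_adjmx (H : sgraph) : \tr (adjmx R H) = 0.
Proof. by apply: big1 => i _; rewrite mxE adj_irr. Qed.

Lemma handshake r : regular G r -> (#|G| * r = #|edge G| * 2)%N.
Proof.
move=> /incmx_mul_tr/(congr1 mxtrace); rewrite mxtrace_mulC tr_mul_incmx.
rewrite !mxtraceD mxtrace_adjmx (mxtrace_adjmx (line_graph G)) !mxtrace_scalar.
rewrite !add0r -!mulrnA => /eqP.
by rewrite eqr_nat mulnC [X in _ == X]mulnC => /eqP.
Qed.

Lemma trmx_adjmx (H : sgraph) : (adjmx R H)^T = adjmx R H.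
Proof. by apply/matrixP => i j; rewrite !mxE adj_sym. Qed.

Lemma trmx_adjmxQ : (adjmxQ R G)^T = adjmxQ R G.
Proof. by apply/matrixP => i j; rewrite !mxE adj_sym. Qed.

(* A vector killed by [N^T] takes opposite values at adjacent vertices, so by
   connectedness it vanishes nowhere and its signs bipartition the graph. *)
Lemma tr_incmx_inj (x : 'cV[R]_#|G|) :
  connected G -> ~ bipartite G -> N^T *m x = 0 -> x = 0.
Proof.
move=> [_ conn] nbip Nx0; pose y (u : G) := x (enum_rank u) 0.
have opp u v : adj u v -> y v = - y u.
  move=> uv; have [f Df] := edge_pair uv.
  have /matrixP/(_ (enum_rank f) 0) := Nx0; rewrite !mxE.
  under eq_bigr do rewrite !mxE enum_rankK Df.
  rewrite (reindex_onto enum_rank enum_val) /= => [|i _]; last exact: enum_valK.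
  under eq_bigl do rewrite enum_rankK eqxx.
  under eq_bigr do rewrite enum_rankK mulr_natl mulrb.
  rewrite -big_mkcond big_setU1 ?inE ?adj_neq //= big_set1 => /eqP.
  by rewrite addrC addr_eq0 => /eqP.
have abs u v : `|y u| = `|y v|.
  have /connectP[p uP ->] := conn u v.
  elim: p u uP => //= w p IH u /andP[/opp uw /IH <-].
  by rewrite uw normrN.
apply/colP => i; rewrite mxE; apply/eqP/negP => /negP xi0; apply: nbip.
exists [set v | 0 < y v] => u v /opp uv; rewrite !inE uv oppr_gt0.
have : y u != 0 by rewrite -normr_eq0 (abs u (enum_val i)) normr_eq0 /y enum_valK.
by case: ltgtP.
Qed.
End Incidence.

(** * The values [lamQ] as roots of a quadratic *)

Section Scalars.
Variables (R : rcfType) (r : nat).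
Implicit Types l : R.

(** This is the sum of the two roots of the quadratic; with [lamQ_root] it makes the two vectors X
    built on one [x] orthogonal. *)
Lemma lamQ_opp_sign s l : lamQ r (~~ s) l = r%:R + l - 2 - lamQ r s l.
Proof. by rewrite /lamQ; case: s; rewrite /= expr0 expr1; field. Qed.

Lemma lamQ_root s l : lamQ r s l * (lamQ r s l + 2 - r%:R - l) = l + r%:R.
Proof.
have w2 : Num.sqrt ((l + r%:R) ^+ 2 + 4) ^+ 2 = (l + r%:R) ^+ 2 + 4.
  by rewrite sqr_sqrtr // addr_ge0 ?sqr_ge0.
have e2 : ((-1) ^+ s) ^+ 2 = 1 :> R by rewrite -exprM mulnC exprM sqrrN !expr1n.
(* Only the squares of the root [w] and of the sign [e] matter: the product is
   [(e w + b) (e w - b) / 4] with [b = r + l - 2]. *)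
rewrite /lamQ; move: (Num.sqrt _) ((-1) ^+ s) w2 e2 => w e w2 e2.
transitivity ((e ^+ 2 * w ^+ 2 - (r%:R + l - 2) ^+ 2) / 4); first by field.
by rewrite e2 w2; field.
Qed.

(** At [t = -2] the quadratic would give [2 (l + r) = l + r]. *)
Lemma lamQ_neqN2 s l : 0 < l + r%:R -> lamQ r s l != -2.
Proof.
by move=> l_gt; apply/eqP => lE; have := lamQ_root s l; rewrite lE; lra.
Qed.

(** The quadratic is linear in [l], namely [(t + 1) (l + r) = t (t + 2)], and [t = -1] is
    impossible, so [t] determines [l]. The sign follows because the square root is positive. *)
Lemma lamQ_inj s s' l l' :
  lamQ r s l = lamQ r s' l' -> (s, l) = (s', l').
Proof.
move=> eq_t; have := lamQ_root s l; have := lamQ_root s' l'.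
rewrite -eq_t; set t := lamQ r s l => e' e.
have t1 : t + 1 != 0.
  by apply/eqP => /eqP; rewrite addr_eq0 => /eqP tE; rewrite tE in e; lra.
have ll' : l = l'.
  apply: (mulfI t1); apply/eqP; rewrite -subr_eq0; apply/eqP.
  have -> : (t + 1) * l - (t + 1) * l' =
    t * (t + 2 - r%:R - l') - (l' + r%:R) - (t * (t + 2 - r%:R - l) - (l + r%:R)).
    by ring.
  by rewrite e e' !subrr.
subst l'; have w_gt0 : 0 < Num.sqrt ((l + r%:R) ^+ 2 + 4).
  by rewrite sqrtr_gt0 ltr_wpDl ?sqr_ge0.
congr pair; move: eq_t; rewrite /lamQ.
by case: s {e t t1 e'}; case: s' => //=; rewrite expr0 expr1; lra.
Qed.

End Scalars.

(** * Eigenvectors of the Q-graph and their inner products *)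

Section Eigen.
Variables (R : rcfType) (G : sgraph) (r : nat).
Local Notation N := (incmx R G).
Hypothesis regG : regular G r.

Lemma incmx_tr_eigen l (x : 'cV[R]_#|G|) :
  adjmx R G *m x = l *: x -> N *m (N^T *m x) = (l + r%:R) *: x.
Proof.
move=> Ax; rewrite mulmxA (incmx_mul_tr _ regG) mulmxDl Ax mul_scalar_mx.
by rewrite scalerDl.
Qed.

(** [(l + r) |x|^2 = |N^T x|^2], which is positive by injectivity of [N^T]. *)
Lemma adjmx_eigen_gt l (x : 'cV[R]_#|G|) : connected G -> ~ bipartite G ->
  eigenvector (adjmx R G) l x -> 0 < l + r%:R.
Proof.
move=> conn nbip [x0 /incmx_tr_eigen Nx].
have xx : 0 < dotv x x by rewrite lt0r dotv_eq0 x0 dotv_ge0.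
rewrite -(pmulr_lgt0 _ xx) -dotvZr -Nx -dotv_trl lt0r dotv_eq0 dotv_ge0 andbT.
by apply: contraNneq x0 => /(tr_incmx_inj conn nbip) ->.
Qed.

Lemma adjmxQ_mul_col (a : 'cV[R]_#|G|) b :
  adjmxQ R G *m col_mx a b =
    col_mx (N *m b) (N^T *m a + N^T *m (N *m b) - 2 *: b).
Proof.
rewrite adjmxQE mul_block_col mul0mx add0r; congr col_mx.
have -> : adjmx R (line_graph G) = N^T *m N - 2%:M by rewrite tr_mul_incmx addrK.
by rewrite mulmxBl mul_scalar_mx mulmxA addrA.
Qed.

Lemma adjmxQ_vecX s l (x : 'cV[R]_#|G|) : adjmx R G *m x = l *: x ->
  adjmxQ R G *m vecX r s l x = lamQ r s l *: vecX r s l x.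
Proof.
move=> /incmx_tr_eigen Nx; rewrite /vecX -scalemxAr.
rewrite [RHS]scalerA [in RHS]mulrC -[RHS]scalerA; congr (_ *: _).
(* With [t = lamQ r s l] and [c = t + 2 - r - l], the upper block needs [l + r = t c] and the lower
   one [c + (l + r) - 2 = t]. *)
rewrite adjmxQ_mul_col Nx scale_col_mx scalerA lamQ_root -!scalemxAr -scalerDl.
by rewrite -scalerBl; congr (col_mx _ (_ *: _)); ring.
Qed.

Lemma adjmxQ_vecY z : N *m z = 0 -> adjmxQ R G *m vecY z = -2 *: vecY z.
Proof.
move=> Nz; rewrite /vecY -scalemxAr.
rewrite [RHS]scalerA [in RHS]mulrC -[RHS]scalerA; congr (_ *: _).
by rewrite adjmxQ_mul_col Nz !mulmx0 !add0r scale_col_mx scaler0 scaleNr.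
Qed.

Lemma dotv_vecX_vecY s l x z : N *m z = 0 -> dotv (vecX r s l x) (vecY z) = 0.
Proof.
move=> Nz; rewrite dotvZl dotvZr dotv_col_mx dotv0r dotv_trl Nz dotv0r.
by rewrite addr0 !mulr0.
Qed.

Lemma dotv_vecY (z z' : 'cV[R]_#|edge G|) : dotv z z = 1 -> dotv z' z' = 1 ->
  dotv (vecY z) (vecY z') = dotv z z'.
Proof.
move=> z1 z1'; rewrite /vecY /norm2 z1 z1' sqrtr1 invr1 !scale1r dotv_col_mx.
by rewrite dotv0l add0r.
Qed.

Lemma dotv_vecX_orth s l s' l' (x x' : 'cV[R]_#|G|) :
  adjmx R G *m x' = l' *: x' -> dotv x x' = 0 ->
  dotv (vecX r s l x) (vecX r s' l' x') = 0.
Proof.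
move=> /incmx_tr_eigen Nx' xx'; rewrite dotvZl dotvZr dotv_col_mx dotv_trl Nx'.
by rewrite !dotvZl !dotvZr xx' !mulr0 addr0 !mulr0.
Qed.

(** Since [|N^T x|^2 = l + r] for unit [x], the unnormalised columns have inner product
    [c c' + l + r], where [c], [c'] are their upper coefficients; for equal signs this is the square
    of the normalising factor. *)
Lemma dotv_vecX s s' l (x : 'cV[R]_#|G|) : 0 < l + r%:R ->
  adjmx R G *m x = l *: x -> dotv x x = 1 ->
  dotv (vecX r s l x) (vecX r s' l x) = (s == s')%:R.
Proof.
move=> l_gt /incmx_tr_eigen Nx xx; rewrite dotvZl dotvZr dotv_col_mx dotv_trl Nx.
rewrite !dotvZl !dotvZr xx !mulr1.
have [->|ne] := eqVneq s s'.
  set c := lamQ _ _ _ + _ - _ - _.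
  have n_gt0 : 0 < c ^+ 2 + l + r%:R by rewrite -addrA ltr_wpDl ?sqr_ge0.
  rewrite mulrA -invfM -expr2 sqr_sqrtr ?ltW // -expr2 addrA mulVf //.
  by rewrite gt_eqF.
have -> : s' = ~~ s by case: s s' ne => [] [].
(* the two roots of [c ^+ 2 + (l + r - 2) * c - (l + r)] have product [- (l + r)] *)
rewrite (_ : _ + (l + r%:R) = 0) ?mulr0 //.
by rewrite lamQ_opp_sign -(lamQ_root r s l); ring.
Qed.

End Eigen.

(** * Assembly of the full spectrum *)

Theorem theorem3p1 (R : rcfType) (G : sgraph) (r d : nat)
    (lam : 'I_d.+1 -> R) (a : 'I_d.+1 -> nat)
    (x : forall i : 'I_d.+1, 'I_(a i) -> 'cV[R]_#|G|)
    (zeta : 'I_(#|edge G| - #|G|)%N -> 'cV[R]_#|edge G|)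
    (r_ge2 : (2 <= r)%N)
    (G_reg : regular G r) (G_conn : connected G) (G_nonbip : ~ bipartite G)
    (lam0 : lam ord0 = r%:R)
    (lam_decr : forall i j : 'I_d.+1, (i < j)%N -> lam j < lam i)
    (lam_all : forall mu : R,
       eigenvalue (adjmx R G) mu <-> exists i, mu = lam i)
    (a_mult : forall i, multiplicity (adjmx R G) (lam i) = a i)
    (x_eigen : forall i j, eigenvector (adjmx R G) (lam i) (x i j))
    (x_orth : forall i, orthonormal_fam (x i))
    (zeta_ker : forall k, incmx R G *m zeta k = 0)
    (zeta_orth : orthonormal_fam zeta) :
  [/\ forall mu : R, eigenvalue (adjmxQ R G) mu <->
        (exists i s, mu = lamQ r s (lam i)) \/
        (mu = -2 /\ (0 < #|edge G| - #|G|)%N)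
    & char_poly (adjmxQ R G) =
        (\prod_i \prod_(s : bool) ('X - (lamQ r s (lam i))%:P) ^+ a i) *
        ('X - (-2)%:P) ^+ (#|edge G| - #|G|)%N] /\
  [/\ forall i s, multiplicity (adjmxQ R G) (lamQ r s (lam i)) = a i,
      forall i s j,
        eigenvector (adjmxQ R G) (lamQ r s (lam i)) (vecX r s (lam i) (x i j))
    & orthonormal_fam (fun p : {i : 'I_d.+1 & (bool * 'I_(a i))%type} =>
        vecX r (tagged p).1 (lam (tag p)) (x (tag p) (tagged p).2))] /\
  [/\ multiplicity (adjmxQ R G) (-2) = (#|edge G| - #|G|)%N,
      forall k, eigenvector (adjmxQ R G) (-2) (vecY (zeta k)),
      orthonormal_fam (fun k => vecY (zeta k))
    & forall i s j k, dotv (vecX r s (lam i) (x i j)) (vecY (zeta k)) = 0].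
Proof.
set A := adjmx R G; set Q := adjmxQ R G.
set q := (_ - _)%N in zeta zeta_ker zeta_orth *.
have symA : A^T = A by exact: trmx_adjmx.
have lam_inj : injective lam.
  move=> i j eq_l; apply/eqP; rewrite -val_eqE /=.
  by case: ltngtP => // /lam_decr; rewrite eq_l ltxx.
(* Each [lam i] is a root of the characteristic polynomial; positivity of [a i] then provides an
   actual eigenvector [x i j] from which to derive [lam_gt]. *)
have a_gt0 i : (0 < a i)%N.
  rewrite -a_mult /multiplicity mup_geq; last first.
    by rewrite monic_neq0 ?char_poly_monic.
  by rewrite expr1 dvdp_XsubCl -eigenvalue_root_char; apply/lam_all; exists i.
have lam_gt i : 0 < lam i + r%:R.
  exact: (adjmx_eigen_gt G_reg G_conn G_nonbip (x_eigen i (Ordinal (a_gt0 i)))).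
have sum_a : (\sum_i a i = #|G|)%N.
  have [s chA] := symmetric_char_poly_split symA.
  have -> : #|G| = size s.
    by apply/eqP; rewrite -eqSS -(size_char_poly A) chA size_prod_XsubC.
  (* [a i] counts the occurrences of [lam i] in the list [s] of roots; after exchanging sums, each
     root is counted once because it equals exactly one [lam i]. *)
  under eq_bigr do
    rewrite -a_mult /multiplicity chA mu_prod_XsubC -sum1_count big_mkcond.
  rewrite exchange_big -sum1_size /=; apply: eq_big_seq => z zs.
  have /lam_all[i ->] : eigenvalue A z.
    by rewrite eigenvalue_root_char chA root_prod_XsubC.
  by rewrite -big_mkcond (big_pred1 i) // => j; rewrite /= eq_sym (inj_eq lam_inj).
(* This makes the truncated subtraction [q] the true difference, so that [2 n + q = n + m]. *)
have le_nm : (#|G| <= #|edge G|)%N.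
  by rewrite -(leq_pmul2r (ltn0Sn 1)) -(handshake R G_reg) leq_mul2l r_ge2 orbT.
have Ax i j : A *m x i j = lam i *: x i j by have [] := x_eigen i j.
have X_orth : orthonormal_fam (fun p : {i : 'I_d.+1 & (bool * 'I_(a i))%type} =>
        vecX r (tagged p).1 (lam (tag p)) (x (tag p) (tagged p).2)).
  move=> [i [s j]] [i' [s' j']] /=; have [ii'|ne] := eqVneq i i'; last first.
    rewrite (@dotv_vecX_orth _ _ _ G_reg) ?Ax //; last first.
      by apply: (eigenvector_dot0 symA (Ax i j) (Ax i' j')); rewrite (inj_eq lam_inj).
    by case: eqP => // /(congr1 tag) /= /eqP; rewrite (negPf ne).
  (* Folding the pairs back into [Tagged] lets [eq_Tagged] reduce their equality to that of the
     components. *)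
  subst i'; rewrite -[in RHS]/(Tagged _ (s, j)) -[in RHS]/(Tagged _ (s', j')).
  rewrite eq_Tagged /= xpair_eqE; have [->|ne] := eqVneq j j'.
    by rewrite (dotv_vecX G_reg) ?andbT // x_orth eqxx.
  by rewrite andbF (@dotv_vecX_orth _ _ _ G_reg) ?Ax // x_orth (negPf ne).
have zz k : dotv (zeta k) (zeta k) = 1 by rewrite zeta_orth eqxx.
have Y_orth : orthonormal_fam (fun k => vecY (zeta k)).
  by move=> k k'; rewrite dotv_vecY.
have XY i s j k : dotv (vecX r s (lam i) (x i j)) (vecY (zeta k)) = 0.
  exact: dotv_vecX_vecY.
have chQ : char_poly Q =
    (\prod_i \prod_(s : bool) ('X - (lamQ r s (lam i))%:P) ^+ a i) *
    ('X - (-2)%:P) ^+ q.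
  (* The vectors X and Y are merged into one family over a disjoint sum, whose cardinality is the
     order of [Q]. *)
  pose T := ({i : 'I_d.+1 & (bool * 'I_(a i))%type} + 'I_q)%type.
  pose mu (t : T) := match t with
    | inl p => lamQ r (tagged p).1 (lam (tag p)) | inr _ => -2 end.
  pose v (t : T) := match t with
    | inl p => vecX r (tagged p).1 (lam (tag p)) (x (tag p) (tagged p).2)
    | inr k => vecY (zeta k) end.
  rewrite (@char_poly_orthonormal _ _ Q T mu v); first last.
  - case=> [[i [s j]]|k]; first exact: adjmxQ_vecX.
    exact: adjmxQ_vecY.
  - case=> [p|k] [p'|k'] /=; [exact: X_orth | exact: XY | | exact: Y_orth].
    by rewrite dotvC; apply: XY.
  - rewrite card_sum card_ord -sum1_card.
    rewrite -(sig_big_dep (fun _ => true) (fun _ _ => true) (fun _ _ => 1%N)) /=.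
    under eq_bigr do rewrite sum1_card card_prod card_bool card_ord.
    rewrite -big_distrr /= sum_a mul2n -addnn -addnA subnKC //.
  - exact: trmx_adjmxQ.
  (* The product over [T] is regrouped: its factors do not depend on [j] or [k], which yields the
     exponents [a i] and [q]. *)
  rewrite big_sumType /= prodr_const card_ord; congr (_ * _).
  rewrite -(sig_big_dep (fun _ => true) (fun _ _ => true)
    (fun i (p : bool * 'I_(a i)) => 'X - (lamQ r p.1 (lam i))%:P)) /=.
  apply: eq_bigr => i _.
  rewrite -(pair_bigA _ (fun s (j : 'I_(a i)) => 'X - (lamQ r s (lam i))%:P)) /=.
  by apply: eq_bigr => s _; rewrite prodr_const card_ord.
(* All factors with root [z] are added up; injectivity of [lamQ] and [lamQ_neqN2] later leave a
   single contribution. *)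
have mulQ z : multiplicity Q z =
    (\sum_(p : 'I_d.+1 * bool | lamQ r p.2 (lam p.1) == z) a p.1
     + (-2 == z)%R * q)%N.
  rewrite /multiplicity chQ.
  rewrite (pair_bigA _ (fun i s => ('X - (lamQ r s (lam i))%:P) ^+ a i)).
  rewrite mupM ?mup_prod_XsubCX ?mup_XsubCX ?expf_neq0 ?polyXsubC_eq0 //=.
    by rewrite eq_sym mulnbl.
  by apply/prodf_neq0 => p _; rewrite expf_neq0 ?polyXsubC_eq0.
have mulX i s : multiplicity Q (lamQ r s (lam i)) = a i.
  rewrite mulQ eq_sym (negPf (lamQ_neqN2 _ (lam_gt i))) addn0.
  rewrite (big_pred1 (i, s)) // => -[j s'] /=.
  by apply/eqP/eqP => [/lamQ_inj[-> /lam_inj->]|[-> ->]].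
have mulY : multiplicity Q (-2) = q.
  rewrite mulQ big_pred0 ?eqxx ?mul1n // => -[i s] /=.
  by rewrite (negPf (lamQ_neqN2 _ (lam_gt i))).
have eigQ z : eigenvalue Q z = (0 < multiplicity Q z)%N.
  rewrite eigenvalue_root_char /multiplicity mup_geq ?expr1 ?dvdp_XsubCl //.
  by rewrite monic_neq0 ?char_poly_monic.
split; [split=> // mu|split; split=> //].
- rewrite eigQ; split=> [|[[i [s ->]]|[-> q0]]]; last 2 first.
  + by rewrite mulX.
  + by rewrite mulY.
  rewrite mulQ addn_gt0 => /orP[|].
    rewrite lt0n sum_nat_eq0 negb_forall => /existsP[[i s]].
    by rewrite negb_imply => /andP[/eqP <- _]; left; exists i, s.
  by case: eqP => // <-; rewrite mul1n; right.
- move=> i s j; split; last exact: adjmxQ_vecX.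
  by rewrite -dotv_eq0 (dotv_vecX G_reg) ?x_orth ?eqxx ?oner_eq0.
- move=> k; split; last exact: adjmxQ_vecY.
  by rewrite -dotv_eq0 Y_orth eqxx oner_eq0.
Qed.
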